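(* Let $c>0$, $\beta\ge 0$, $\tau\ge 0$, $q_u\in\mathbb{N}$ (so $q_u\ge 1$), $q_v\in\mathbb{N}\cup\{0\}$, and consider the uniform periodic grid with $N$ cells of width $h$ on $\Omega=[x_{\rm L},x_{\rm R}]$ and its staggered dual grid. Let $\mathcal{L}_c:U_h^{q_u-1}\times\widetilde V_h^{q_v}\to U_h^{q_u-1}\times\widetilde V_h^{q_v}$ be the staggered energy-based discontinuous Galerkin spatial operator with periodic boundary conditions and numerical fluxes $H,G$ (with parameters $\beta,\tau$) defined in the context. Then $$\|\mathcal{L}_c\|\le\frac{c}{h}C_{3,\frac12}(q_u+q_v-1)+\frac{c}{h}C_{4,\frac12}\sqrt{q_u(q_v+1)}+\frac{c}{h}C_5\max\left\{c\beta q_u^2,\frac{\tau}{c}(q_v+1)^2\right\},$$ where $C_{3,\frac12}\le\frac{8\sqrt3+4}{3}$, $C_{4,\frac12}\le\frac{128}{\sqrt3\,\pi}$ and $C_5\le 4$ are universal positive constants, independent of $q_u$, $q_v$, $h$, $\beta$, $\tau$. In particular, when $\beta=\tau=0$, or when $\beta=\frac{\hat\beta}{q_u c}$ and $\tau=\frac{c\hat\tau}{q_v+1}$ with fixed dimensionless constants $\hat\beta,\hat\tau\ge 0$, the norm $\|\mathcal{L}_c\|$ is bounded linearly in $q_u$ and $q_v$; that is, $\|\mathcal{L}_c\|\le C\,\frac{c}{h}(q_u+q_v)$ with a constant $C$ (depending only on $\hat\beta,\hat\tau$ in the second case) independent of $q_u$, $q_v$ and $h$.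
   Context: Setting: the one-dimensional wave equation $u_t=v$, $v_t=c^2u_{xx}$ with constant speed $c>0$ on $\Omega=[x_{\rm L},x_{\rm R}]$ with periodic boundary conditions. Grids: $x_j=x_{\rm L}+jh$, $j=0,\dots,N$, $h=(x_{\rm R}-x_{\rm L})/N$, $I_j=[x_j,x_{j+1}]$. Element centers are $\rho_j=x_{j+\frac12}=(x_j+x_{j+1})/2$ and the staggered grid has elements $I_{j+\frac12}=[\rho_j,\rho_{j+1}]$. All indices are taken periodically ($x_0$ and $x_N$ are identified, and the last staggered element wraps around), and sums $\sum_j$ run over the $N$ cells. Spaces: $\mathbb{Q}^{k}(I)$ is the space of polynomials of degree at most $k$ on $I$, and $$U_h^{k}=\{w: w|_{I_j}\in\mathbb{Q}^{k}(I_j)\ \forall j\},\qquad \widetilde V_h^{k}=\{w: w|_{I_{j+\frac12}}\in\mathbb{Q}^{k}(I_{j+\frac12})\ \forall j\}.$$ Spatial derivatives of functions in these spaces are understood piecewise (element by element). One-sided limits are $\phi^{\pm}(x)=\lim_{\varepsilon\to0\pm}\phi(x+\varepsilon)$ (periodically). Numerical fluxes, for $w\in U_h^{q_u-1}$ and $v\in\widetilde V_h^{q_v}$: $$H(v,w)=v-\beta c^2(w^--w^+)\ \text{ at the points } x_j,\qquad G(w,v)=w-\frac{\tau}{c^2}(v^--v^+)\ \text{ at the points }\rho_j$$ ($v$ is single valued at $x_j$ and $w$ is single valued at $\rho_j$). Operator: $\mathcal{L}_c$ is defined by requiring, for all $w,\varphi\in U_h^{q_u-1}$ and $v,\psi\in\widetilde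 V_h^{q_v}$, $$\int_\Omega\mathcal{L}_c(cw,v)(c\varphi,\psi)\,dx=-c^2\sum_j\left(\int_{x_j}^{x_{j+1}}\varphi_x v\,dx-\varphi^-H(v,w)\big|_{x_{j+1}}+\varphi^+H(v,w)\big|_{x_j}\right)$$ $$\qquad-c^2\sum_j\left(\int_{\rho_j}^{\rho_{j+1}}\psi_x w\,dx-\psi^-G(w,v)\big|_{\rho_{j+1}}+\psi^+G(w,v)\big|_{\rho_j}\right),$$ where the left-hand side denotes the $L^2(\Omega)^2$ inner product of the pair $\mathcal{L}_c(cw,v)$ with the pair $(c\varphi,\psi)$. Operator norm: $$\|\mathcal{L}_c\|=\sup\frac{\int_\Omega\mathcal{L}_c(cw,v)(c\varphi,\psi)\,dx}{(\|cw\|_{L^2(\Omega)}^2+\|v\|_{L^2(\Omega)}^2)^{1/2}(\|c\varphi\|_{L^2(\Omega)}^2+\|\psi\|_{L^2(\Omega)}^2)^{1/2}},$$ the supremum being over $w,\varphi\in U_h^{q_u-1}$, $v,\psi\in\widetilde V_h^{q_v}$ with $(w,v)\ne(0,0)$ and $(\varphi,\psi)\ne(0,0)$. *)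

(* Defs.v *)
From mathcomp Require Import all_boot all_order all_algebra.
From mathcomp Require Import all_classical all_reals all_analysis.
Set Implicit Arguments.
Unset Strict Implicit.
Unset Printing Implicit Defensive.
Import Order.TTheory GRing.Theory Num.Theory.
Import numFieldNormedType.Exports.
Local Open Scope classical_set_scope.
Local Open Scope ring_scope.

Section StaggeredDG.
Variable R : realType.
Implicit Types (a b c beta tau xL xR : R) (N qu qv j k : nat).
Implicit Types (f w v phi psi : R -> R).

Definition integral_on a b f : R :=
  \int[@lebesgue_measure R]_(x in `[a, b]) f x.

Definition trace_l f (x : R) : R := lim (f y @[y --> x^'-]).
Definition trace_r f (x : R) : R := lim (f y @[y --> x^'+]).

Definition width N xL xR : R := (xR - xL) / N%:R.
(* Nodes and element centers are indexed by all of nat: functions on the periodic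
   domain are functions on R of period xR - xL, so that no index is ever
   reduced modulo N. *)
Definition node N xL xR j : R := xL + j%:R * width N xL xR.
Definition dual_node N xL xR j : R :=
  (node N xL xR j + node N xL xR j.+1) / 2.

(* Piecewise polynomials of degree at most k. The value at a breakpoint, which
   is immaterial, is fixed to be the limit from the right; hence two elements
   of the space that agree almost everywhere are equal. *)
Definition broken_poly N (L : R) (brk : nat -> R) k : set (R -> R) :=
  [set w | (forall x, w (x + L) = w x) /\
    forall j, (j < N)%N -> exists2 p : {poly R}, (size p <= k.+1)%N &
      forall x, brk j <= x < brk j.+1 -> w x = p.[x] ].

Definition Uh N xL xR k : set (R -> R) :=
  broken_poly N (xR - xL) (node N xL xR) k.
Definition Vh N xL xR k : set (R -> R) :=
  broken_poly N (xR - xL) (dual_node N xL xR) k.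

Definition fluxH c beta v w (x : R) : R :=
  v x - beta * c ^+ 2 * (trace_l w x - trace_r w x).
Definition fluxG c tau w v (x : R) : R :=
  w x - tau / c ^+ 2 * (trace_l v x - trace_r v x).

(* derive1 is the pointwise derivative: it is the elementwise derivative away
   from the breakpoints, which are negligible for the integrals below. *)
Definition dg_form N xL xR c beta tau w v phi psi : R :=
  let x_ := node N xL xR in
  let rho_ := dual_node N xL xR in
  - c ^+ 2 * (\sum_(j < N)
      (integral_on (x_ j) (x_ j.+1) (fun x => derive1 phi x * v x)
       - trace_l phi (x_ j.+1) * fluxH c beta v w (x_ j.+1)
       + trace_r phi (x_ j) * fluxH c beta v w (x_ j)))
  - c ^+ 2 * (\sum_(j < N)
      (integral_on (rho_ j) (rho_ j.+1) (fun x => derive1 psi x * w x)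
       - trace_l psi (rho_ j.+1) * fluxG c tau w v (rho_ j.+1)
       + trace_r psi (rho_ j) * fluxG c tau w v (rho_ j))).

Definition pair_inner xL xR (F G : (R -> R) * (R -> R)) : R :=
  integral_on xL xR (fun x => F.1 x * G.1 x + F.2 x * G.2 x).

Definition L2norm xL xR f : R :=
  Num.sqrt (integral_on xL xR (fun x => f x ^+ 2)).

Definition is_dg_operator N xL xR c beta tau qu qv
    (Lc : (R -> R) * (R -> R) -> (R -> R) * (R -> R)) : Prop :=
  (forall w v, Uh N xL xR qu.-1 w -> Vh N xL xR qv v ->
     Uh N xL xR qu.-1 (Lc (w, v)).1 /\ Vh N xL xR qv (Lc (w, v)).2) /\
  (forall w v phi psi,
     Uh N xL xR qu.-1 w -> Vh N xL xR qv v ->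
     Uh N xL xR qu.-1 phi -> Vh N xL xR qv psi ->
     pair_inner xL xR (Lc (c \*o w, v)) (c \*o phi, psi)
     = dg_form N xL xR c beta tau w v phi psi).

(* The supremum is taken in the extended reals, where it is meaningful without
   assuming boundedness. *)
Definition dg_opnorm N xL xR c qu qv
    (Lc : (R -> R) * (R -> R) -> (R -> R) * (R -> R)) : \bar R :=
  ereal_sup [set r : \bar R | exists w v phi psi,
    [/\ Uh N xL xR qu.-1 w /\ Vh N xL xR qv v,
        Uh N xL xR qu.-1 phi /\ Vh N xL xR qv psi,
        (w, v) <> (cst 0, cst 0),
        (phi, psi) <> (cst 0, cst 0) &
        r = (pair_inner xL xR (Lc (c \*o w, v)) (c \*o phi, psi)
             / (Num.sqrt (L2norm xL xR (c \*o w) ^+ 2 + L2norm xL xR v ^+ 2)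
                * Num.sqrt (L2norm xL xR (c \*o phi) ^+ 2
                            + L2norm xL xR psi ^+ 2)))%:E ]].

End StaggeredDG.

(* Main.v *)
Require Import Defs.
From mathcomp Require Import all_boot all_order all_algebra.
From mathcomp Require Import all_classical all_reals all_analysis.
From mathcomp Require Import zify ring lra.
Import Order.TTheory GRing.Theory Num.Theory.
Import numFieldNormedType.Exports.
Local Open Scope classical_set_scope.
Local Open Scope ring_scope.

(** Up to the numerical dissipation, the form splits into two copies of one
    bilinear form
      B(phi, v) = sum_j (int_(I_j) phi' v - [phi]_j v(x_j)),
    where phi is broken at the nodes x_j, with jump [phi]_j = phi^- - phi^+, and
    v at the cell centers: the copy
    B(phi, v) on the given pair of grids, and B(psi, w) on the pair obtained by
    shifting both grids by half a cell ([half_form_eq]). The norm of B grows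
    only linearly in the degrees, although differentiating a polynomial of
    degree k on a cell costs k^2 / h, because the k^2 growth occurs only near
    the two ends of the cell, and the ends of the cells of one grid are the
    centers of the cells of the other. Let eta be the hat function that is 1
    at the centers of the cells of phi and 0 at their ends. Integrating the
    part weighted by 1 - eta by parts moves the derivative to v, and all the
    boundary terms cancel against the jumps ([coupling_hat]):
      B(phi, v) = int eta phi' v - int (1 - eta) phi v' + int eta' phi v.
    On the reference cell [0, 2], eta(t)^2 <= t (2 - t), and
      int t (2 - t) p'^2 <= k (k + 1) int p^2   for deg p <= k
    ([bernstein_L2]), so eta phi' has norm at most (2 / h) (k + 1/2) |phi|. In
    the same way (1 - eta)^2 is at most the weight of the cells of v, and
    |eta'| = 2 / h. With k = q_u - 1 and m = q_v this gives
      |B(phi, v)| <= (2 / h) (k + m + 2) |phi| |v| = (2 / h) (q_u + q_v + 1) |phi| |v|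
    ([coupling_le]), and since q_u + q_v + 1 = (q_u + q_v - 1) + 2 with
    1 <= sqrt (q_u (q_v + 1)), the constants 2 and 4 are admissible for C3 and
    C4.

    The dissipation is a sum of products of jumps; the trace inequality
    p(0)^2, p(2)^2 <= (k + 1)^2 / 2 int p^2 ([trace_L2]) bounds it with C5 = 4
    ([jumps_le]).

    Both polynomial inequalities are proved by induction on the degree, by
    adding one Legendre polynomial L at a time. They rest on the orthogonality
    of L to lower degrees: if an operator A maps L to d L plus lower terms, then
    int (A L) L = d int L^2.

    Quantities are bounded by Young's inequality with a free parameter e, in
    the form e |.|^2 + |.|^2 / e, which passes through the sums over the cells;
    e is chosen as the ratio of the two norms at the very end ([dg_form_le]). *)

Set Implicit Arguments.
Unset Strict Implicit.
Unset Printing Implicit Defensive.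

(** * Integration of polynomials *)

Section PolynomialIntegral.
Variable R : realType.
Implicit Types (p q r f g : {poly R}) (a b c s : R).

(** The integral of a polynomial is defined through its formal antiderivative,
    so that linearity, additivity, integration by parts and affine substitution
    are algebra; only positivity needs analysis. *)
Definition antideriv p : {poly R} :=
  \poly_(i < (size p).+1) (p`_i.-1 / i%:R).

Lemma antiderivK p : (antideriv p)^`() = p.
Proof.
apply/polyP => i; rewrite coef_deriv coef_poly ltnS /=.
case: ltnP => [_|ip]; last by rewrite mul0rn nth_default.
by rewrite -[LHS]mulr_natr divfK// pnatr_eq0.
Qed.

Lemma derivK p : antideriv p^`() = p - p.[0]%:P.
Proof.
apply/polyP => -[|i]; rewrite coef_poly coefB coefC horner_coef0 /=.
  by rewrite invr0 mulr0 subrr.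
rewrite subr0 coef_deriv ltnS; case: ltnP => [_|ip].
  by rewrite -[X in X / _]mulr_natr mulfK// pnatr_eq0.
by have /eqP := nth_default 0 ip; rewrite coef_deriv mulrn_eq0 => /= /eqP ->.
Qed.

Definition pint a b p : R := (antideriv p).[b] - (antideriv p).[a].

Lemma pint_deriv a b p : pint a b p^`() = p.[b] - p.[a].
Proof. by rewrite /pint derivK !hornerE; ring. Qed.

Lemma pintD a b p q : pint a b (p + q) = pint a b p + pint a b q.
Proof.
rewrite -{1}(antiderivK p) -{1}(antiderivK q) -derivD pint_deriv !hornerD /pint.
move: (antideriv p) (antideriv q) => P Q.
by ring.
Qed.

Lemma pintZ a b s p : pint a b (s *: p) = s * pint a b p.
Proof. by rewrite -{1}(antiderivK p) -derivZ pint_deriv !hornerZ -mulrBr. Qed.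

Lemma pintN a b p : pint a b (- p) = - pint a b p.
Proof. by rewrite -scaleN1r pintZ mulN1r. Qed.

Lemma pintB a b p q : pint a b (p - q) = pint a b p - pint a b q.
Proof. by rewrite pintD pintN. Qed.

Lemma pint0 a b : pint a b 0 = 0.
Proof. by rewrite -(scale0r 0) pintZ mul0r. Qed.

Lemma pint_cat a b c p : pint a c p = pint a b p + pint b c p.
Proof. by rewrite /pint; ring. Qed.

Lemma pint_affine a b s c p :
  s * pint a b (p \Po (s *: 'X + c%:P)) = pint (s * a + c) (s * b + c) p.
Proof.
rewrite -pintZ -{1}(antiderivK p).
have -> : s *: ((antideriv p)^`() \Po (s *: 'X + c%:P)) =
    (antideriv p \Po (s *: 'X + c%:P))^`().
  rewrite deriv_comp derivD derivC addr0 derivZ derivX mulrC.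
  by rewrite -alg_polyC mulr_algl.
by rewrite pint_deriv !horner_comp !hornerE.
Qed.

Lemma pint_ge0 a b p : a <= b -> (forall x, a <= x <= b -> 0 <= p.[x]) ->
  0 <= pint a b p.
Proof.
move=> ab p0; rewrite subr_ge0.
apply: (@ger0_derive1_ndecr _ _ a b) => // [x|].
- rewrite in_itv/= => /andP[ax xb].
  by rewrite -derivE antiderivK p0// !ltW.
- by apply: continuous_subspaceT; exact: continuous_horner.
Qed.

Lemma pint_sqr_ge0 a b p : a <= b -> 0 <= pint a b (p ^+ 2).
Proof. by move=> ab; apply: pint_ge0 => // x _; rewrite horner_exp sqr_ge0. Qed.

Lemma pint_le a b p q : a <= b -> (forall x, a <= x <= b -> p.[x] <= q.[x]) ->
  pint a b p <= pint a b q.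
Proof.
move=> ab pq; rewrite -subr_ge0 -pintB pint_ge0// => x /pq.
by rewrite !hornerE subr_ge0.
Qed.

(** Expand 0 <= int (e p -+ q)^2 and divide by e. *)
Lemma pint_young a b e p q : a <= b -> 0 < e ->
  `|pint a b (p * q)| <= (e * pint a b (p ^+ 2) + e^-1 * pint a b (q ^+ 2)) / 2.
Proof.
move=> ab e0.
have ie : 0 < e^-1 by rewrite invr_gt0.
have ee : e^-1 * e = 1 by rewrite mulVf ?gt_eqF.
have key s : s ^+ 2 = 1 ->
    s * pint a b (p * q) <= (e * pint a b (p ^+ 2) + e^-1 * pint a b (q ^+ 2)) / 2.
  move=> s2; have := pint_sqr_ge0 (e *: p - s *: q) ab.
  have -> : (e *: p - s *: q) ^+ 2 =
     (e ^+ 2) *: p ^+ 2 + (- (2 * e * s)) *: (p * q) + (s ^+ 2) *: q ^+ 2.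
    by rewrite -!mul_polyC !(polyCN, polyCM, rmorphXn) /= -[2%:P]/(2%:R%:P) polyC_natr; ring.
  rewrite !pintD !pintZ s2 mul1r => H.
  have := mulr_ge0 (ltW ie) H.
  have -> : forall X Y Z, e^-1 * (e ^+ 2 * X + - (2 * e * s) * Y + Z) =
     (e^-1 * e) * (e * X - 2 * s * Y) + e^-1 * Z by move=> *; ring.
  by rewrite ee; lra.
rewrite ler_norml; have := key 1 (expr1n _ 2); have := key (-1) (etrans (sqrrN 1) (expr1n _ 2)).
by lra.
Qed.

Lemma pint_parts a b p q :
  pint a b (p^`() * q) = p.[b] * q.[b] - p.[a] * q.[a] - pint a b (p * q^`()).
Proof.
by apply/eqP; rewrite eq_sym subr_eq eq_sym -pintD -derivM pint_deriv !hornerE.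
Qed.

End PolynomialIntegral.

(** * Inverse inequalities for polynomials on [0, 2] *)

Section InverseInequalities.
Variable R : realType.
Implicit Types (p q r f g L : {poly R}) (a b c e s x y : R) (k : nat).

Local Notation I2 := (pint 0 2).

(** The difference of the two sides is (e x - y)^2 / e. *)
Lemma sqr_young e x y : 0 < e -> 2 * x * y <= e * x ^+ 2 + e^-1 * y ^+ 2.
Proof.
move=> e0; rewrite -subr_ge0.
have -> : e * x ^+ 2 + e^-1 * y ^+ 2 - 2 * x * y = e^-1 * (e * x - y) ^+ 2.
  by field; rewrite gt_eqF.
by rewrite mulr_ge0 ?sqr_ge0// invr_ge0 ltW.
Qed.

(** The degenerate case of Cauchy-Schwarz, which lets [orth_proj] project
    along L without showing that int L^2 is nonzero. *)
Lemma pint_sqr_eq0_orth f L : I2 (L * L) = 0 -> I2 (f * L) = 0.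
Proof.
move=> LL; apply: contrapT => /eqP fL.
(* this multiple t of L would make int (f - t L)^2 equal to -1 *)
have := pint_sqr_ge0 (f - ((I2 (f * f) + 1) / (2 * I2 (f * L))) *: L) (ler0n R 2).
have -> : forall t, (f - t *: L) ^+ 2 = f * f - (2 * t) *: (f * L) + (t ^+ 2) *: (L * L).
  by move=> t; rewrite -!mul_polyC !rmorphM /= polyC_natr; ring.
rewrite pintD pintB !pintZ LL mulr0 addr0.
have -> : 2 * ((I2 (f * f) + 1) / (2 * I2 (f * L))) * I2 (f * L) = I2 (f * f) + 1.
  by field.
by lra.
Qed.

Lemma size_monic_split k L p : L`_k = 1 -> (size L <= k.+1)%N -> (size p <= k.+1)%N ->
  exists2 r : {poly R}, (size r <= k)%N & p = p`_k *: L + r.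
Proof.
move=> L1 sL sp; exists (p - p`_k *: L); last by rewrite addrC subrK.
apply/leq_sizeP => j; rewrite leq_eqVlt => /predU1P[<-|kj].
  by rewrite coefB coefZ L1 mulr1 subrr.
by rewrite coefB coefZ (nth_default 0 (leq_trans sp kj)) (nth_default 0 (leq_trans sL kj)) mulr0 subrr.
Qed.

(** Gram-Schmidt: the projection onto degree < k.+1 is the projection onto
    degree < k plus the component along L = X^k - (projection of X^k). *)
Lemma orth_proj k f : exists2 r : {poly R}, (size r <= k)%N &
  forall q, (size q <= k)%N -> I2 ((f - r) * q) = 0.
Proof.
elim: k f => [|k IH] f.
  by exists 0 => [|q]; rewrite ?size_poly0// leqn0 size_poly_eq0 => /eqP->; rewrite mulr0 pint0.
have [r sr fr] := IH f; have [s ss Xs] := IH 'X^k.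
set L := 'X^k - s in Xs.
have L1 : L`_k = 1 by rewrite coefB coefXn eqxx nth_default// subr0.
have sL : (size L <= k.+1)%N.
  by rewrite (leq_trans (size_polyD _ _))// size_polyN size_polyXn geq_max leqnn leqW.
(* if int L^2 = 0 then c = 0, and int f L = 0 as well *)
set c := I2 (f * L) / I2 (L * L).
exists (r + c *: L) => [|q sq].
  rewrite (leq_trans (size_polyD _ _))// geq_max (leqW sr)/=.
  by rewrite (leq_trans (size_scale_leq _ _)).
have [q' sq' ->] := size_monic_split L1 sL sq.
have -> : (f - (r + c *: L)) * (q`_k *: L + q') =
    q`_k *: (f * L - L * r - c *: (L * L)) + (f - r) * q' - c *: (L * q').
  by rewrite -!mul_polyC; ring.
rewrite pintB pintD !pintZ !pintB pintZ fr// (Xs r)// (Xs q')//.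
have -> : I2 (f * L) = c * I2 (L * L).
  rewrite /c; have [LL|LL] := eqVneq (I2 (L * L)) 0; last by rewrite divfK.
  by rewrite LL mulr0 pint_sqr_eq0_orth.
by ring.
Qed.

Lemma legendre k : exists L : {poly R}, [/\ L`_k = 1, (size L <= k.+1)%N &
  forall q, (size q <= k)%N -> I2 (L * q) = 0].
Proof.
have [s ss Xs] := orth_proj k 'X^k; exists ('X^k - s); split => //.
  by rewrite coefB coefXn eqxx nth_default// subr0.
by rewrite (leq_trans (size_polyD _ _))// size_polyN size_polyXn geq_max leqnn leqW.
Qed.

(** The weight of the Legendre operator; it vanishes at both ends of [0, 2]. *)
Let W : {poly R} := 'X * (2 - 'X).

(** The Legendre operator -(W p')' is triangular on monomials, with diagonal
    entries k (k + 1). *)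
Lemma legendre_op_low k p : (size p <= k.+1)%N ->
  (size ((W * p^`())^`() + (k * k.+1)%:R *: p)%R <= k)%N.
Proof.
move=> sp; apply/leq_sizeP => j kj.
have -> : W * p^`() = 2 *: ('X * p^`()) - 'X * ('X * p^`()).
  by rewrite /W -mul_polyC polyC_natr; ring.
have pj1 : p`_j.+1 = 0 by rewrite nth_default// (leq_trans sp).
rewrite derivB derivZ !coefD coefN !coefZ !coef_deriv !coefXM !coef_deriv /= pj1 !mul0rn mulr0 add0r.
move: kj; rewrite leq_eqVlt => /predU1P[<-|kj].
  case: k {sp pj1} => [|k] /=; first by rewrite mul0rn mul0n mul0r oppr0 addr0.
  by rewrite -mulrnA mulr_natl addNr.
have -> : p`_j = 0 by rewrite nth_default// (leq_trans sp).
case: j {pj1} kj => // j kj /=; rewrite mulr0 addr0.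
by rewrite nth_default ?(leq_trans sp)// !mul0rn oppr0.
Qed.

(** (X - 1) p' has the same leading term as k p; the center 1 of [0, 2] is
    chosen to make X - 1 take opposite values at the two ends. *)
Lemma euler_op_low k p : (size p <= k.+1)%N ->
  (size (('X - 1) * p^`() - k%:R *: p)%R <= k)%N.
Proof.
move=> sp; apply/leq_sizeP => j kj.
have pj1 : p`_j.+1 = 0 by rewrite nth_default// (leq_trans sp).
rewrite mulrBl mul1r !coefB coefZ coefXM !coef_deriv pj1 mul0rn subr0.
move: kj; rewrite leq_eqVlt => /predU1P[<-|kj].
  case: k {sp pj1} => [|k] /=; first by rewrite mul0r subrr.
  by rewrite mulr_natl subrr.
have -> : p`_j = 0 by rewrite nth_default// (leq_trans sp).
by case: j {pj1} kj => // j kj /=; rewrite nth_default ?(leq_trans sp)// mul0rn mulr0 subrr.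
Qed.

Lemma pint_W_parts p q : I2 (W * (p^`() * q^`())) = - I2 ((W * p^`())^`() * q).
Proof.
rewrite pint_parts.
have -> : (W * p^`()).[2] = 0 by rewrite /W !hornerE subrr mulr0 mul0r.
have -> : (W * p^`()).[0] = 0 by rewrite /W !hornerE.
by rewrite !mul0r subrr sub0r opprK mulrA.
Qed.

(** An operator that maps L to d L plus lower terms acts on the square norm of L
    as if L were an eigenvector. *)
Lemma legendre_eig k L (d : R) A : (forall q, (size q <= k)%N -> I2 (L * q) = 0) ->
  (size (A - d *: L)%R <= k)%N -> I2 (A * L) = d * I2 (L ^+ 2).
Proof.
move=> oL sA; apply/eqP; rewrite -subr_eq0 -pintZ -pintB.
by rewrite expr2 scalerAl -mulrBl mulrC oL.
Qed.

Lemma pint_sqr_split k L p r c : (forall q, (size q <= k)%N -> I2 (L * q) = 0) ->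
  (size r <= k)%N -> I2 ((c *: L + r) ^+ 2) = c ^+ 2 * I2 (L ^+ 2) + I2 (r ^+ 2).
Proof.
move=> oL sr.
have -> : (c *: L + r) ^+ 2 = (c ^+ 2) *: L ^+ 2 + (2 * c) *: (L * r) + r ^+ 2.
  by rewrite -!mul_polyC !rmorphM /= polyC_natr; ring.
by rewrite !pintD !pintZ oL// mulr0 addr0.
Qed.

(** Write p = c L + r with deg r < k. The cross term int W L' r' vanishes, as it
    equals int L (-(W r')') and the operator does not raise the degree of r;
    the diagonal terms are k (k + 1) int (c L)^2 and the induction hypothesis. *)
Lemma bernstein_L2 k p : (size p <= k)%N ->
  I2 (W * p^`() ^+ 2) <= (k%:R - 1) * k%:R * I2 (p ^+ 2).
Proof.
elim: k p => [|k IH] p sp.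
  move: sp; rewrite leqn0 size_poly_eq0 => /eqP->.
  by rewrite deriv0 expr0n /= mulr0 pint0 mulr0.
have [L [L1 sL oL]] := legendre k.
have [r sr ->] := size_monic_split L1 sL sp; move: (p`_k) => c.
rewrite (pint_sqr_split _ _ oL)//.
have sA q : (size q <= k.+1)%N ->
    (size ((- (W * q^`())^`()) - (k * k.+1)%:R *: q)%R <= k)%N.
  by move=> sq; rewrite -opprD size_polyN legendre_op_low.
have WLL : I2 (W * (L^`() * L^`())) = (k * k.+1)%:R * I2 (L ^+ 2).
  by rewrite pint_W_parts -pintN -mulNr (legendre_eig oL (sA _ sL)).
have WLr : I2 (W * (L^`() * r^`())) = 0.
  rewrite [L^`() * _]mulrC pint_W_parts -pintN -mulNr mulrC oL//.
  have := sA r (leqW sr); set A := - (W * _)^`() => sAr.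
  rewrite -[A](subrK ((k * k.+1)%:R *: r)) (leq_trans (size_polyD _ _))//.
  by rewrite geq_max sAr (leq_trans (size_scale_leq _ _)).
have -> : W * (c *: L + r)^`() ^+ 2 = (c ^+ 2) *: (W * (L^`() * L^`()))
   + (2 * c) *: (W * (L^`() * r^`())) + W * r^`() ^+ 2.
  rewrite derivD derivZ.
  by rewrite -!mul_polyC !rmorphM /= polyC_natr; ring.
rewrite !pintD !pintZ WLL WLr mulr0 addr0.
have := IH r sr; have := pint_sqr_ge0 r (ler0n R 2).
rewrite natrM -natr1; set n := k%:R => r0 H.
have n0 : 0 <= n by rewrite ler0n.
have := mulr_ge0 n0 r0; nra.
Qed.

(** int ((X - 1) L^2)' = (1 + 2 k) int L^2 is the sum of the squares of the end
    values, and int (L^2)' = 2 int L L' = 0 is their difference. *)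
Lemma legendre_end k L x : (size L <= k.+1)%N ->
  (forall q, (size q <= k)%N -> I2 (L * q) = 0) -> (x == 0) || (x == 2) ->
  L.[x] ^+ 2 = (2 * k%:R + 1) / 2 * I2 (L ^+ 2).
Proof.
move=> sL oL x02.
have D : I2 (L * L^`()) = 0.
  apply: oL; apply/leq_sizeP => j kj.
  by rewrite coef_deriv nth_default ?mul0rn// (leq_trans sL).
have D' : I2 (L^`() * L) = 0 by rewrite mulrC.
have E : I2 (('X - 1) * L^`() * L) = k%:R * I2 (L ^+ 2).
  exact: legendre_eig oL (euler_op_low sL).
have := pint_parts 0 2 L L; have := pint_parts 0 2 (('X - 1) * L) L.
have -> : (('X - 1) * L)^`() * L = L ^+ 2 + ('X - 1) * L^`() * L.
  by rewrite derivM derivB derivX derivC; ring.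
have -> : ('X - 1) * L * L^`() = ('X - 1) * L^`() * L by ring.
rewrite pintD E D D' !hornerE subr0.
by move: x02 => /orP[] /eqP-> ; lra.
Qed.

(** With p = c L + r, the bound (2 k + 1) / 2 for L and the bound k^2 / 2 for r
    add up, by Cauchy-Schwarz, to (k + 1)^2 / 2. *)
Lemma trace_L2 k p x : (size p <= k)%N -> (x == 0) || (x == 2) ->
  p.[x] ^+ 2 <= k%:R ^+ 2 / 2 * I2 (p ^+ 2).
Proof.
move=> sp x02; elim: k p sp => [|k IH] p sp.
  move: sp; rewrite leqn0 size_poly_eq0 => /eqP->.
  by rewrite horner0 expr0n /= !mul0r.
have [L [L1 sL oL]] := legendre k.
have [r sr ->] := size_monic_split L1 sL sp; move: (p`_k) => c.
rewrite (pint_sqr_split _ _ oL)// hornerD hornerZ.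
have := legendre_end sL oL x02; have := IH r sr.
have := pint_sqr_ge0 r (ler0n R 2).
have := pint_sqr_ge0 L (ler0n R 2).
move: (I2 (L ^+ 2)) (I2 (r ^+ 2)) => U V U0 V0.
case: k {IH sr sL oL L1 sp} => [|k].
  rewrite expr0n /= !mul0r mulr0 add0r => H1 H2.
  have -> : r.[x] = 0.
    by apply/eqP; rewrite -sqrf_eq0 eq_le H1 sqr_ge0.
  rewrite addr0 exprMn H2 expr1n mulrCA.
  by rewrite ler_wpM2l ?divr_ge0// lerDl.
set n := k.+1%:R : R; have n0 : 0 < n by rewrite ltr0n.
have -> : k.+2%:R = n + 1 :> R by rewrite natr1.
move: (L.[x]) (r.[x]) => l y H1 H2.
have : 2 * (c * l) * y <= n ^+ 2 / (2 * n + 1) * (c * l) ^+ 2 + (2 * n + 1) / n ^+ 2 * y ^+ 2.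
  have -> : (2 * n + 1) / n ^+ 2 = (n ^+ 2 / (2 * n + 1))^-1 by rewrite invf_div.
  by apply: sqr_young; rewrite divr_gt0 ?exprn_gt0//; lra.
have -> : n ^+ 2 / (2 * n + 1) * (c * l) ^+ 2 = n ^+ 2 / 2 * (c ^+ 2 * U).
  by rewrite exprMn H2; field; apply/eqP; lra.
have : (2 * n + 1) / n ^+ 2 * y ^+ 2 <= (2 * n + 1) / 2 * V.
  have -> : (2 * n + 1) / 2 * V = (2 * n + 1) / n ^+ 2 * (n ^+ 2 / 2 * V).
    by field; rewrite gt_eqF.
  by rewrite ler_wpM2l// divr_ge0 ?exprn_ge0//; lra.
have : (c * l) ^+ 2 = (2 * n + 1) / 2 * (c ^+ 2 * U) by rewrite exprMn H2; ring.
move: H1; move: (c ^+ 2 * U) (c * l) => a u.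
set Z := _ / _ * y ^+ 2.
by clearbody Z; nra.
Qed.

End InverseInequalities.

(** * The coupling and jump forms on the reference cells *)

Section ReferenceForm.
Variable R : realType.
Implicit Types (p q r f g L : {poly R}) (a b c e s x y : R) (k m N : nat).
Implicit Types (P Q W : nat -> {poly R}).

Local Notation I1 := (pint 0 1).
Local Notation I2 := (pint 0 2).

(** The reference cell [0, 2] is cut into two halves that are both referred to
    [0, 1]: a polynomial p on the cell is p on the left half and shiftp p on the
    right half. *)
Definition shiftp p : {poly R} := p \Po ('X + 1).

Lemma horner_shiftp p x : (shiftp p).[x] = p.[x + 1].
Proof. by rewrite horner_comp !hornerE. Qed.

Lemma shiftpM p q : shiftp (p * q) = shiftp p * shiftp q.
Proof. exact: comp_polyM. Qed.

Lemma deriv_shiftp p : (shiftp p)^`() = shiftp p^`().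
Proof. by rewrite deriv_comp derivD derivX -[1]/(1%:P) derivC addr0 mulr1. Qed.

Lemma pint_halves p : I2 p = I1 p + I1 (shiftp p).
Proof.
rewrite (pint_cat _ 1); congr (_ + _).
have := pint_affine 0 1 1 1 p.
by rewrite mul1r scale1r mulr0 add0r mulr1 -[1 + 1]/(2%:R).
Qed.

(** The left-hand side is the square norm of eta p' for the hat function eta
    that is X on [0, 1] and 2 - X on [1, 2]; eta^2 <= X (2 - X). *)
Lemma hat_bernstein k p : (size p <= k.+1)%N ->
  I1 (('X * p^`()) ^+ 2) + I1 (((1 - 'X) * (shiftp p)^`()) ^+ 2)
  <= (k%:R + 2^-1) ^+ 2 * I2 (p ^+ 2).
Proof.
move=> sp; apply: le_trans (_ : k%:R * k.+1%:R * I2 (p ^+ 2) <= _); last first.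
  by rewrite ler_wpM2r ?pint_sqr_ge0// -natr1; nra.
have := bernstein_L2 sp; rewrite -[in k.+1%:R - 1]natr1 addrK.
apply: le_trans; rewrite pint_halves lerD// pint_le// => x /andP[x0 x1].
  rewrite !hornerE exprMn; move: (_.[x]) => y; rewrite /=.
  by have := mulr_ge0 (sqr_ge0 y) (mulr_ge0 x0 (_ : 0 <= 1 - x)); rewrite subr_ge0 => /(_ x1); nra.
rewrite deriv_shiftp horner_shiftp !hornerE horner_shiftp exprMn.
move: (_.[_]) => y; rewrite /=.
by have := mulr_ge0 (sqr_ge0 y) (mulr_ge0 x0 (_ : 0 <= 1 - x)); rewrite subr_ge0 => /(_ x1); nra.
Qed.

(** Integration by parts of the part of f' weighted by 1 - X only: this hat
    function vanishes at 1, so that the only boundary term is at 0. *)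
Lemma half_parts_l f g : I1 (f^`() * g) =
  I1 (('X * f^`()) * g) - I1 (f * ((1 - 'X) * g^`())) + I1 (f * g) - f.[0] * g.[0].
Proof.
have := pint_parts 0 1 ((1 - 'X) * f) g.
rewrite -!polyC1 derivM derivB derivX derivC sub0r.
rewrite !hornerM !hornerD !hornerN !hornerX !hornerC subrr subr0 !mul0r mul1r sub0r.
have -> : (- 1%:P * f + (1%:P - 'X) * f^`()) * g =
   f^`() * g - 'X * f^`() * g - f * g.
  by rewrite polyC1; ring.
have -> : (1%:P - 'X) * f * g^`() = f * ((1%:P - 'X) * g^`()) by ring.
by rewrite !pintB; lra.
Qed.

Lemma half_parts_r f g : I1 (f^`() * g) =
  I1 (((1 - 'X) * f^`()) * g) - I1 (f * ('X * g^`())) - I1 (f * g) + f.[1] * g.[1].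
Proof.
have := pint_parts 0 1 ('X * f) g.
rewrite derivM derivX !hornerM !hornerX !mul0r !mul1r subr0.
have -> : (f + 'X * f^`()) * g =
   f^`() * g - (1 - 'X) * f^`() * g + f * g by ring.
have -> : 'X * f * g^`() = f * ('X * g^`()) by ring.
by rewrite !pintD pintN; lra.
Qed.

(** The left neighbour of cell j on the periodic grid, moved up by one period so
    that it is a natural number when j = 0. *)
Definition cyc_pred N j : nat := (j + N).-1.
Definition cyclic_seq (T : Type) N (F : nat -> T) := forall j, F (j + N)%N = F j.

Lemma cyc_pred_succ (T : Type) N (F : nat -> T) j : (0 < N)%N -> cyclic_seq N F ->
  F (cyc_pred N j.+1) = F j.
Proof. by move=> N0 FN; rewrite /cyc_pred addSn/= FN. Qed.

Lemma sum_cyc_pred N (F : nat -> R) : (0 < N)%N -> cyclic_seq N F ->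
  \sum_(j < N) F (cyc_pred N j) = \sum_(j < N) F j.
Proof.
case: N => // N _ FN; rewrite big_ord_recl big_ord_recr /= addrC; congr (_ + _).
by apply: eq_bigr => i _; rewrite /bump /= add1n (cyc_pred_succ _ _ FN).
Qed.

(** B(phi, v) in reference coordinates: P j is phi on the j-th cell, and Q j is v
    on the dual cell whose left half is the right half of the j-th cell. The
    scaling of phi' by 2 / h cancels that of the half cell. *)
Definition coupling N P Q : R := \sum_(j < N)
  (I1 ((P j)^`() * shiftp (Q (cyc_pred N j))) + I1 ((shiftp (P j))^`() * Q j)
   - ((P (cyc_pred N j)).[2] - (P j).[0]) * (Q (cyc_pred N j)).[1]).

Definition sqnorm N P : R := \sum_(j < N) I2 (P j ^+ 2).

(** The boundary terms at the node between cells j - 1 and j are those which the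
    jump of phi times v produces, up to the cyclic relabelling j - 1 -> j. *)
Lemma coupling_hat N P Q : (0 < N)%N -> cyclic_seq N P -> cyclic_seq N Q ->
  coupling N P Q = \sum_(j < N)
   (I1 (('X * (P j)^`()) * shiftp (Q (cyc_pred N j)))
    + I1 ((1 - 'X) * (shiftp (P j))^`() * Q j)
    - I1 (P j * ((1 - 'X) * (shiftp (Q (cyc_pred N j)))^`()))
    - I1 (shiftp (P j) * ('X * (Q j)^`()))
    + I1 (P j * shiftp (Q (cyc_pred N j))) - I1 (shiftp (P j) * Q j)).
Proof.
move=> N0 PN QN.
(* what the boundary terms leave in cell j is T j minus its cyclic predecessor *)
pose T j := (P j).[2] * (Q j).[1].
have TN : cyclic_seq N T by move=> j; rewrite /T PN QN.
apply/eqP; rewrite -subr_eq0 -sumrB.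
rewrite (eq_bigr (fun j : 'I_N => T j - T (cyc_pred N j))) => [|j _].
  by rewrite sumrB sum_cyc_pred// subrr.
rewrite /T half_parts_l half_parts_r !horner_shiftp add0r -[1 + 1]/(2%:R).
by ring.
Qed.

(** Young's inequality with parameter e / (k + 1/2) on the terms with phi', with
    e (m + 1/2) on the terms with v' and with e on the terms without derivative
    makes each derivative cost exactly its degree plus 1/2, by
    [hat_bernstein]; the three contributions add up to k + m + 2. *)
Lemma coupling_le N P Q k m e : (0 < N)%N -> cyclic_seq N P -> cyclic_seq N Q ->
  (forall j, (size (P j) <= k.+1)%N) -> (forall j, (size (Q j) <= m.+1)%N) ->
  0 < e ->
  `|coupling N P Q| <= (k%:R + m%:R + 2) / 2 * (e * sqnorm N P + e^-1 * sqnorm N Q).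
Proof.
move=> N0 PN QN sP sQ e0; rewrite coupling_hat//.
pose ak : R := k%:R + 2^-1; pose am : R := m%:R + 2^-1.
have ak0 : 0 < ak by rewrite ltr_wpDl// ler0n.
have am0 : 0 < am by rewrite ltr_wpDl// ler0n.
have ie0 : 0 < e^-1 by rewrite invr_gt0.
pose B1 j := e / ak * I1 (('X * (P j)^`()) ^+ 2)
  + e / ak * I1 (((1 - 'X) * (shiftp (P j))^`()) ^+ 2)
  + e * (am + 1) * (I1 (P j ^+ 2) + I1 (shiftp (P j) ^+ 2)).
pose G1 j := I1 (shiftp (Q j) ^+ 2).
pose G2 j := I1 (((1 - 'X) * (shiftp (Q j))^`()) ^+ 2).
pose B2 j := (e * am)^-1 * I1 (('X * (Q j)^`()) ^+ 2) + e^-1 * (ak + 1) * I1 (Q j ^+ 2).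
apply: le_trans (ler_norm_sum _ _ _) _.
apply: (@le_trans _ _ (\sum_(j < N) (B1 j + B2 j + e^-1 * (ak + 1) * G1 (cyc_pred N j)
   + (e * am)^-1 * G2 (cyc_pred N j)) / 2)).
  apply: ler_sum => j _.
  have Y e' p q := @pint_young _ 0 1 e' p q ler01.
  have e1 : 0 < e / ak by rewrite divr_gt0.
  have e2 : 0 < e * am by rewrite mulr_gt0.
  have := Y _ ('X * (P j)^`()) (shiftp (Q (cyc_pred N j))) e1.
  have := Y _ ((1 - 'X) * (shiftp (P j))^`()) (Q j) e1.
  have := Y _ (P j) ((1 - 'X) * (shiftp (Q (cyc_pred N j)))^`()) e2.
  have := Y _ (shiftp (P j)) ('X * (Q j)^`()) e2.
  have := Y _ (P j) (shiftp (Q (cyc_pred N j))) e0.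
  have := Y _ (shiftp (P j)) (Q j) e0.
  rewrite !invf_div /B1 /B2 /G1 /G2.
  rewrite !ler_norml; lra.
rewrite -mulr_suml !big_split/= -!mulr_sumr.
have G1N : cyclic_seq N G1 by move=> j; rewrite /G1 QN.
have G2N : cyclic_seq N G2 by move=> j; rewrite /G2 QN.
rewrite (sum_cyc_pred N0 G1N) (sum_cyc_pred N0 G2N).
rewrite !mulr_sumr -!big_split mulr_suml mulr_sumr /=.
apply: ler_sum => j _; rewrite /B1 /B2 /G1 /G2.
have HP := ler_wpM2l (ltW (divr_gt0 e0 ak0)) (hat_bernstein (sP j)).
have HQ := ler_wpM2l (ltW (divr_gt0 ie0 am0)) (hat_bernstein (sQ j)).
move: HP HQ; rewrite -/ak -/am.
rewrite mulrA [e / ak * _ ^+ 2](_ : _ = e * ak); last by field; rewrite gt_eqF.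
rewrite mulrA [e^-1 / am * _ ^+ 2](_ : _ = e^-1 * am); last by field; rewrite !gt_eqF.
have -> : k%:R + m%:R + 2 = ak + am + 1 by rewrite /ak /am; lra.
have sq p : shiftp (p ^+ 2) = shiftp p ^+ 2 by rewrite !expr2 shiftpM.
rewrite !pint_halves !sq invfM.
lra.
Qed.

Definition jumps N P W : R := \sum_(j < N)
  ((P (cyc_pred N j)).[2] - (P j).[0]) * ((W (cyc_pred N j)).[2] - (W j).[0]).

Lemma jumps_diag_le N P k : (0 < N)%N -> cyclic_seq N P ->
  (forall j, (size (P j) <= k.+1)%N) ->
  jumps N P P <= 2 * k.+1%:R ^+ 2 * sqnorm N P.
Proof.
move=> N0 PN sP.
apply: (@le_trans _ _ (\sum_(j < N) (2 * (P (cyc_pred N j)).[2] ^+ 2 + 2 * (P j).[0] ^+ 2))).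
  apply: ler_sum => j _; move: (_.[2]) (_.[0]) => x y.
  have := sqr_ge0 (x + y); lra.
rewrite big_split /= -!mulr_sumr (sum_cyc_pred (F := fun j => (P j).[2] ^+ 2))//; last first.
  by move=> j; rewrite PN.
rewrite -mulrDr -mulrA ler_wpM2l// -big_split /sqnorm mulr_sumr /=.
apply: ler_sum => j _.
have := trace_L2 (x := 0) (sP j); have := trace_L2 (x := 2) (sP j).
by rewrite !eqxx orbT => /(_ isT) H /(_ isT); lra.
Qed.

Lemma jumps_le N P W k e : (0 < N)%N -> cyclic_seq N P -> cyclic_seq N W ->
  (forall j, (size (P j) <= k.+1)%N) -> (forall j, (size (W j) <= k.+1)%N) ->
  0 < e ->
  `|jumps N P W| <= k.+1%:R ^+ 2 * (e * sqnorm N P + e^-1 * sqnorm N W).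
Proof.
move=> N0 PN WN sP sW e0.
have ie0 : 0 < e^-1 by rewrite invr_gt0.
apply: (@le_trans _ _ ((e * jumps N P P + e^-1 * jumps N W W) / 2)).
  rewrite /jumps !mulr_sumr -big_split mulr_suml /=.
  apply: le_trans (ler_norm_sum _ _ _) _; apply: ler_sum => j _.
  move: (_ - _) (_ - _) => x y.
  rewrite ler_norml; have := sqr_young y x e0; have := sqr_young y (- x) e0.
  lra.
have := ler_wpM2l (ltW e0) (jumps_diag_le N0 PN sP).
have := ler_wpM2l (ltW ie0) (jumps_diag_le N0 WN sW).
lra.
Qed.

End ReferenceForm.

(** * Integrals and one-sided limits of functions that are locally polynomial *)

Section PiecewiseIntegral.
Variable R : realType.
Implicit Types (p q r : {poly R}) (f w v phi : R -> R) (a b c d L x y : R) (j k N : nat).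
Local Notation mu := (@lebesgue_measure R).

(** Integrability is carried along because the integrals of adjacent intervals
    may only be added up for integrable functions. *)
Definition has_integral a b f s :=
  mu.-integrable `[a, b] (EFin \o f) /\ integral_on a b f = s.

Lemma integrable_itv_cc a b f :
  mu.-integrable `]a, b[ (EFin \o f) -> mu.-integrable `[a, b] (EFin \o f).
Proof.
move=> fi.
have mfc := measurable_realfun.emeasurable_fun_itv_cc (measurable_int _ fi).
have N0 : mu ([set a] `|` [set b]) = 0%E.
  apply/eqP; rewrite -measure_le0.
  apply: (@le_trans _ _ (mu [set a] + mu [set b])%E); last by rewrite !lebesgue_measure_set1 adde0.
  exact: measureU2.
apply: (proj2 (@negligible_integrable _ _ R mu `[a, b] ([set a] `|` [set b])
  (EFin \o f) _ _ mfc N0)) => //; first exact: measurableU.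
have -> : `[a, b] `\` ([set a] `|` [set b]) = `]a, b[%classic :> set R.
  apply/seteqP; split => x /=; rewrite !in_itv/=.
    move=> [/andP[ax xb] /not_orP[/eqP xa /eqP xb']].
    by rewrite !lt_neqAle ax xb eq_sym xa xb'.
  by move=> /andP[ax xb]; rewrite !ltW//; split => // -[] xE; move: ax xb; rewrite xE ltxx.
exact: fi.
Qed.

Lemma has_integral_poly a b f p : a < b ->
  (forall x, a < x < b -> f x = p.[x]) -> has_integral a b f (pint a b p).
Proof.
move=> ab fp.
have ip : mu.-integrable `[a, b] (EFin \o horner p).
  apply: continuous_compact_integrable; first exact: segment_compact.
  by apply: continuous_subspaceT; exact: continuous_horner.
have ipo : mu.-integrable `]a, b[ (EFin \o horner p).
  by apply: integrableS ip => //; exact: subset_itv_oo_cc.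
have ifo : mu.-integrable `]a, b[ (EFin \o f).
  apply: eq_integrable ipo => // x; rewrite inE /= in_itv/= => xab.
  by rewrite fp.
have oc (g : R -> R) : mu.-integrable `]a, b[ (EFin \o g) ->
    mu.-integrable `[a, b] (EFin \o g) /\ integral_on a b g = \int[mu]_(x in `]a, b[) g x.
  move=> ig; have igc := integrable_itv_cc ig; split => //.
  have igo : mu.-integrable `[a, b[ (EFin \o g).
    by apply: integrableS igc => //; exact: subset_itv_co_cc.
  by rewrite /integral_on -Rintegral_itv_bndo_bndc// -Rintegral_itv_obnd_cbnd.
have [? fE] := oc _ ifo; have [_ pE] := oc _ ipo.
split => //; rewrite fE; transitivity (\int[mu]_(x in `]a, b[) p.[x]).
  by apply: eq_Rintegral => x; rewrite inE /= in_itv/= => /fp.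
rewrite -pE /integral_on /Rintegral.
rewrite (@continuous_FTC2 _ _ (horner (antideriv p)))//.
- by apply: continuous_subspaceT; exact: continuous_horner.
- split.
  + by move=> x _; exact: derivable_horner.
  + by apply: cvg_at_right_filter; exact: continuous_horner.
  + by apply: cvg_at_left_filter; exact: continuous_horner.
- by move=> x _; rewrite -derivE antiderivK.
Qed.

Lemma has_integral_cat a b c f s t : a <= b -> b <= c ->
  has_integral a b f s -> has_integral b c f t -> has_integral a c f (s + t).
Proof.
move=> ab bc [ifl <-] [ifr <-].
have U : `[a, c]%classic = `[a, b] `|` `]b, c] by apply: itv_bndbnd_setU.
have ifro : mu.-integrable `]b, c] (EFin \o f).
  by apply: integrableS ifr => //; exact: subset_itv_oc_cc.
have dj : [disjoint `[a, b]%classic & `]b, c]%classic].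
  apply/disj_setPS => y [/=]; rewrite 2!in_itv/= => /andP[_ yx] /andP[].
  by rewrite ltNge yx.
have ifac : mu.-integrable `[a, c] (EFin \o f).
  have mU g : mu.-integrable `[a, b] g -> mu.-integrable `]b, c] g ->
      measurable_fun (`[a, b] `|` `]b, c]) g.
    move=> /(measurable_int _) gl /(measurable_int _) gr.
    exact: (measurable_funU _ (measurable_itv _) (measurable_itv _)).2 (conj gl gr).
  apply/integrableP; rewrite U; split; first exact: mU.
  rewrite ge0_integral_setU//.
    by move: ifl ifro => /integrableP[_ fl] /integrableP[_ fr]; rewrite lte_add_pinfty.
  by apply: mU; exact: integrable_abse.
split => //; rewrite /integral_on U Rintegral_setU -?U//.
by congr (_ + _); rewrite Rintegral_itv_obnd_cbnd.
Qed.

Lemma trace_lE a x f p : a < x -> (forall y, a < y < x -> f y = p.[y]) ->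
  trace_l f x = p.[x].
Proof.
move=> ax fp; apply: cvg_lim; first exact: Rhausdorff.
apply: cvg_trans (_ : horner p y @[y --> x^'-] --> _).
  apply: near_eq_cvg; near=> y; apply/esym/fp; apply/andP; split.
    by near: y; exact: nbhs_left_gt.
  by near: y; exact: nbhs_left_lt.
by apply: cvg_at_left_filter; exact: continuous_horner.
Unshelve. all: by end_near. Qed.

Lemma trace_rE b x f p : x < b -> (forall y, x < y < b -> f y = p.[y]) ->
  trace_r f x = p.[x].
Proof.
move=> ax fp; apply: cvg_lim; first exact: Rhausdorff.
apply: cvg_trans (_ : horner p y @[y --> x^'+] --> _).
  apply: near_eq_cvg; near=> y; apply/esym/fp; apply/andP; split.
    by near: y; exact: nbhs_right_gt.
  by near: y; exact: nbhs_right_lt.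
by apply: cvg_at_right_filter; exact: continuous_horner.
Unshelve. all: by end_near. Qed.

Lemma derive1_poly_on a b x f p : a < x < b -> (forall y, a < y < b -> f y = p.[y]) ->
  derive1 f x = p^`().[x].
Proof.
move=> axb fp; rewrite derivE !derive1E; apply: near_eq_derive.
have : x \in `]a, b[ by rewrite in_itv.
by move=> /near_in_itvoo; apply: filterS => y; rewrite in_itv => /fp.
Qed.

End PiecewiseIntegral.

(** * Piecewise polynomials in reference coordinates *)

Section Cells.
Variable R : realType.
Implicit Types (p q r : {poly R}) (f w v phi : R -> R) (a b c d L x y t : R) (j k N : nat).
Implicit Types (P Q W T U : nat -> {poly R}).

Local Notation I1 := (pint 0 1).
Local Notation I2 := (pint 0 2).

(** The polynomial on the line whose expression in the coordinate
    t = (x - a) / d is p. *)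
Definition rescale a d p : {poly R} := p \Po (d^-1 *: ('X - a%:P)).

Lemma horner_rescale a d p x : (rescale a d p).[x] = p.[(x - a) / d].
Proof. by rewrite horner_comp !hornerE mulrC. Qed.

Lemma deriv_rescale a d p : (rescale a d p)^`() = d^-1 *: rescale a d p^`().
Proof.
by rewrite deriv_comp derivZ derivB derivX derivC subr0 -mul_polyC mulr1 mulrC mul_polyC.
Qed.

Lemma rescale_on a d l f p : 0 < d ->
  (forall t, 0 < t < l -> f (a + t * d) = p.[t]) ->
  forall x, a < x < a + l * d -> f x = (rescale a d p).[x].
Proof.
move=> d0 fp x /andP[ax xl]; rewrite horner_rescale -fp.
  by congr f; field; rewrite gt_eqF.
by rewrite divr_gt0 ?subr_gt0//= ltr_pdivrMr// ltrBlDl.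
Qed.

Lemma trace_r_cell a d l f p : 0 < d -> 0 < l ->
  (forall t, 0 < t < l -> f (a + t * d) = p.[t]) -> trace_r f a = p.[0].
Proof.
move=> d0 l0 fp; rewrite (@trace_rE _ (a + l * d) _ _ (rescale a d p)).
- by rewrite horner_rescale subrr mul0r.
- by rewrite ltrDl mulr_gt0.
- exact: rescale_on.
Qed.

Lemma trace_l_cell a d l f p : 0 < d -> 0 < l ->
  (forall t, 0 < t < l -> f (a + t * d) = p.[t]) -> trace_l f (a + l * d) = p.[l].
Proof.
move=> d0 l0 fp; rewrite (@trace_lE _ a _ _ (rescale a d p)).
- by rewrite horner_rescale addrAC subrr add0r mulfK// gt_eqF.
- by rewrite ltrDl mulr_gt0.
- exact: rescale_on.
Qed.

Lemma derive1_cell a d l f p t : 0 < d -> 0 < t < l ->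
  (forall t, 0 < t < l -> f (a + t * d) = p.[t]) ->
  derive1 f (a + t * d) = d^-1 * p^`().[t].
Proof.
move=> d0 /andP[t0 tl] fp.
rewrite (@derive1_poly_on _ a (a + l * d) _ _ (rescale a d p)).
- by rewrite deriv_rescale hornerZ horner_rescale addrAC subrr add0r mulfK// gt_eqF.
- by rewrite ltrDl mulr_gt0//= ltrD2l ltr_pM2r.
- exact: rescale_on.
Qed.

Lemma integral_half_cell a d f p : 0 < d ->
  (forall t, 0 < t < 1 -> f (a + t * d) = p.[t]) ->
  has_integral a (a + d) f (d * I1 p).
Proof.
move=> d0 fp.
have -> : d * I1 p = pint a (a + d) (rescale a d p).
  have := pint_affine 0 1 d a (rescale a d p).
  rewrite mulr0 add0r mulr1 [d + a]addrC => <-; congr (_ * pint _ _ _).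
  rewrite /rescale -comp_polyA -[LHS]comp_polyXr; congr (_ \Po _).
  rewrite comp_polyZ comp_polyB comp_polyX comp_polyC addrK scalerA.
  by rewrite mulVf ?gt_eqF// scale1r.
apply: has_integral_poly; first by rewrite ltrDl.
by have := @rescale_on a d 1 f p d0 fp; rewrite mul1r.
Qed.

Lemma integral_cells N a d f T U : 0 < d -> (0 < N)%N ->
  (forall j t, (j < N)%N -> 0 < t < 1 -> f (a + (2 * j%:R + t) * d) = (T j).[t]) ->
  (forall j t, (j < N)%N -> 0 < t < 1 -> f (a + (2 * j%:R + (t + 1)) * d) = (U j).[t]) ->
  has_integral a (a + 2 * N%:R * d) f (d * \sum_(j < N) (I1 (T j) + I1 (U j))).
Proof.
move=> d0; elim: N => // N IH _ fT fU.
have cell : has_integral (a + 2 * N%:R * d) (a + 2 * N.+1%:R * d) f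
    (d * (I1 (T N) + I1 (U N))).
  have H1 := @integral_half_cell (a + 2 * N%:R * d) d f (T N) d0.
  have H2 := @integral_half_cell (a + 2 * N%:R * d + d) d f (U N) d0.
  have -> : a + 2 * N.+1%:R * d = a + 2 * N%:R * d + d + d by rewrite -natr1; ring.
  rewrite mulrDr; apply: (@has_integral_cat _ _ (a + 2 * N%:R * d + d)).
  - by rewrite lerDl ltW.
  - by rewrite lerDl ltW.
  - by apply: H1 => t t01; rewrite -(fT N)//; congr f; ring.
  - by apply: H2 => t t01; rewrite -(fU N)//; congr f; ring.
case: N IH fT fU cell => [|N] IH fT fU cell.
  by move: cell; rewrite big_ord1 mulr0 mul0r addr0.
rewrite big_ord_recr /= [d * _]mulrDr; apply: has_integral_cat cell.
- by rewrite lerDl !mulr_ge0 ?ler0n// ltW.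
- by rewrite lerD2l ler_wpM2r ?ler_wpM2l ?ler_nat// ltW.
- by apply: IH => // j t jN t01; [apply: fT|apply: fU] => //; exact: ltnW.
Qed.

(** Cells have width 2 d and begin at a, and the reference coordinate t of each
    runs over [0, 2); dual cells are obtained by taking a + d for a. *)
Definition cellwise a d w P := forall j t, 0 <= t < 2 ->
  w (a + (2 * j%:R + t) * d) = (P j).[t].

(** The polynomials given on the first N cells are repeated with period N. *)
Lemma cellwise_exists N a d k w : (0 < N)%N -> 0 < d ->
  periodic w (2 * N%:R * d) ->
  (forall j, (j < N)%N -> exists2 p : {poly R}, (size p <= k.+1)%N &
     forall x, a + 2 * j%:R * d <= x < a + 2 * j.+1%:R * d -> w x = p.[x]) ->
  exists P, [/\ cyclic_seq N P, forall j, (size (P j) <= k.+1)%N & cellwise a d w P].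
Proof.
move=> N0 d0 wL wp.
have /choice[P HP] j : exists p : {poly R}, (size p <= k.+1)%N /\
   forall t, 0 <= t < 2 -> w (a + (2 * (j %% N)%N%:R + t) * d) = p.[t].
  have [p sp pE] := wp (j %% N)%N (ltn_pmod j N0).
  exists (p \Po (d *: 'X + (a + 2 * (j %% N)%N%:R * d)%:P)); split.
    apply: leq_trans (size_comp_poly_leq _ _) _; rewrite ltnS.
    have s2 : (size (d *: 'X + (a + 2 * (j %% N)%N%:R * d)%:P)%R <= 2)%N.
      rewrite (leq_trans (size_polyD _ _))// geq_max (leq_trans (size_scale_leq _ _)) ?size_polyX//=.
      by rewrite (leq_trans (size_polyC_leq1 _)).
    by rewrite -[k]muln1 leq_mul// -subn1 leq_subLR add1n.
  move=> t /andP[t0 t2]; rewrite horner_comp !hornerE /= -pE.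
    by congr w; ring.
  have := mulr_ge0 t0 (ltW d0); have : t * d < 2 * d by rewrite ltr_pM2r.
  rewrite -natr1; lra.
exists (fun j => P (j %% N)%N); split.
- by move=> j; rewrite /= modnDr.
- by move=> j; case: (HP (j %% N)%N).
move=> j t t02; case: (HP (j %% N)%N) => _ /(_ t t02) <-.
rewrite modn_mod [in LHS](divn_eq j N) -[RHS](periodicn wL (j %/ N)).
by congr w; rewrite natrD natrM -[in RHS]mulr_natr; ring.
Qed.

(** Two half-cell shifts return to the original grid up to renumbering: this
    makes the dual of the dual grid usable in [half_form_eq]. *)
Lemma cellwise_shift a d w P : cellwise a d w P ->
  cellwise (a + d + d) d w (fun j => P j.+1).
Proof. by move=> wP j t t02; rewrite -wP//; congr w; rewrite -natr1; ring. Qed.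

Lemma cellwise_pred N a d w P j t : (0 < N)%N -> periodic w (2 * N%:R * d) ->
  cellwise a d w P -> 0 <= t < 2 ->
  w (a + (2 * j%:R + t - 2) * d) = (P (cyc_pred N j)).[t].
Proof.
move=> N0 wL wP t02; rewrite -wP// -[LHS]wL; congr w.
have -> : (cyc_pred N j)%:R = j%:R + N%:R - 1 :> R.
  by rewrite -natrD -[in RHS](@prednK (j + N)) ?addn_gt0 ?N0 ?orbT// -natr1 addrK.
by ring.
Qed.

Lemma trace_r_cellwise a d w P j : 0 < d -> cellwise a d w P ->
  trace_r w (a + 2 * j%:R * d) = (P j).[0].
Proof.
move=> d0 wP; apply: (@trace_r_cell _ d 2) => // t /andP[t0 t2].
by rewrite -wP ?ltW// ?t2//; congr w; ring.
Qed.

Lemma trace_l_cellwise N a d w P j : (0 < N)%N -> 0 < d ->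
  periodic w (2 * N%:R * d) -> cellwise a d w P ->
  trace_l w (a + 2 * j%:R * d) = (P (cyc_pred N j)).[2].
Proof.
move=> N0 d0 wL wP.
have -> : a + 2 * j%:R * d = (a + 2 * j%:R * d - 2 * d) + 2 * d by rewrite subrK.
apply: trace_l_cell => // t /andP[t0 t2].
rewrite -(cellwise_pred _ N0 wL wP) ?ltW ?t2//.
by congr w; ring.
Qed.

Lemma integral_cellwise_sqr N a d w P : (0 < N)%N -> 0 < d -> cellwise a d w P ->
  integral_on a (a + 2 * N%:R * d) (fun x => w x ^+ 2) = d * sqnorm N P.
Proof.
move=> N0 d0 wP.
have sq p : I2 (p ^+ 2) = I1 (p ^+ 2) + I1 (shiftp p ^+ 2).
  by rewrite pint_halves !expr2 shiftpM.
have -> : sqnorm N P = \sum_(j < N) (I1 (P j ^+ 2) + I1 (shiftp (P j) ^+ 2)).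
  by apply: eq_bigr => j _.
apply: (integral_cells d0 N0 (T := fun j => P j ^+ 2) (U := fun j => shiftp (P j) ^+ 2) _ _).2
  => j t _ /andP[t0 t1].
  by rewrite wP ?horner_exp// ltW//=; lra.
by rewrite wP ?horner_exp ?horner_shiftp//; apply/andP; split; lra.
Qed.

Lemma integral_cellwise_dual_sqr N a d v Q : (0 < N)%N -> 0 < d ->
  periodic v (2 * N%:R * d) -> cyclic_seq N Q -> cellwise (a + d) d v Q ->
  integral_on a (a + 2 * N%:R * d) (fun x => v x ^+ 2) = d * sqnorm N Q.
Proof.
move=> N0 d0 vL QN vQ.
have -> : sqnorm N Q = \sum_(j < N) (I1 (shiftp (Q (cyc_pred N j)) ^+ 2) + I1 (Q j ^+ 2)).
  rewrite big_split /= (sum_cyc_pred (F := fun j => I1 (shiftp (Q j) ^+ 2)))//; last first.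
    by move=> j; rewrite QN.
  rewrite -big_split; apply: eq_bigr => j _.
  by rewrite pint_halves !expr2 shiftpM /= addrC.
apply: (integral_cells d0 N0 (T := fun j => shiftp (Q (cyc_pred N j)) ^+ 2) (U := fun j => Q j ^+ 2) _ _).2
  => j t _ /andP[t0 t1].
  rewrite horner_exp horner_shiftp -(cellwise_pred _ N0 vL vQ).
    by congr (v _ ^+ 2); ring.
  by apply/andP; split; lra.
rewrite horner_exp -vQ; first by congr (v _ ^+ 2); ring.
by apply/andP; split; lra.
Qed.

Lemma sum_cyc_succ N (F : nat -> R) : (0 < N)%N -> cyclic_seq N F ->
  \sum_(j < N) F j.+1 = \sum_(j < N) F j.
Proof.
move=> N0 FN; rewrite -(sum_cyc_pred (F := fun j => F j.+1))//; last first.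
  by move=> j; rewrite -addSn FN.
apply: eq_bigr => j _; rewrite /cyc_pred prednK ?FN// addn_gt0 N0 orbT //.
Qed.

(** Both halves of the DG form are instances: w and phi may be broken at the
    nodes and v at the centers, or conversely with a moved by half a cell. *)
Lemma half_form_eq N a d gamma phi w v P W Q : (0 < N)%N -> 0 < d ->
  let L := 2 * N%:R * d in
  periodic phi L -> periodic w L -> periodic v L ->
  cyclic_seq N P -> cyclic_seq N W -> cyclic_seq N Q ->
  cellwise a d phi P -> cellwise a d w W -> cellwise (a + d) d v Q ->
  let x_ j := a + 2 * j%:R * d in
  let flux x := v x - gamma * (trace_l w x - trace_r w x) in
  \sum_(j < N) (integral_on (x_ j) (x_ j.+1) (fun x => derive1 phi x * v x)
     - trace_l phi (x_ j.+1) * flux (x_ j.+1) + trace_r phi (x_ j) * flux (x_ j))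
  = coupling N P Q + gamma * jumps N P W.
Proof.
move=> N0 d0 L phiL wL vL PN WN QN phiP wW vQ x_ flux.
pose fl j := (Q (cyc_pred N j)).[1] - gamma * ((W (cyc_pred N j)).[2] - (W j).[0]).
have flE j : flux (x_ j) = fl j.
  rewrite /flux /fl (trace_r_cellwise _ d0 wW) (trace_l_cellwise _ N0 d0 wL wW).
  rewrite -(cellwise_pred _ N0 vL vQ) ?ler01 ?ltr1n//; congr (v _ - _).
  by rewrite /x_; ring.
have dphi j t : 0 < t < 2 -> derive1 phi (a + (2 * j%:R + t) * d) = d^-1 * (P j)^`().[t].
  move=> t02; rewrite mulrDl addrA.
  apply: derive1_cell t02 _ => // s /andP[s0 s2].
  by rewrite -addrA -mulrDl phiP// ltW.
have cell j : integral_on (x_ j) (x_ j.+1) (fun x => derive1 phi x * v x) =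
    I1 ((P j)^`() * shiftp (Q (cyc_pred N j))) + I1 ((shiftp (P j))^`() * Q j).
  have -> : x_ j.+1 = x_ j + 2 * 1%:R * d by rewrite /x_ -natr1; ring.
  have [//||_ ->] := @integral_cells 1 (x_ j) d (fun x => derive1 phi x * v x)
    (fun=> d^-1 *: ((P j)^`() * shiftp (Q (cyc_pred N j))))
    (fun=> d^-1 *: ((shiftp (P j))^`() * Q j)) d0 isT.
  - move=> i t; rewrite ltnS leqn0 => /eqP-> /andP[t0 t1].
    rewrite mulr0 add0r /x_ -addrA -mulrDl dphi; last by rewrite t0; lra.
    rewrite hornerZ hornerM horner_shiftp -mulrA -(cellwise_pred _ N0 vL vQ); last first.
      by apply/andP; split; lra.
    by congr (_ * (_ * v _)); ring.
  - move=> i t; rewrite ltnS leqn0 => /eqP-> /andP[t0 t1].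
    rewrite mulr0 add0r /x_ -addrA -mulrDl dphi; last by apply/andP; split; lra.
    rewrite hornerZ hornerM deriv_shiftp horner_shiftp -mulrA -(vQ j); last first.
      by apply/andP; split; lra.
    by congr (_ * (_ * v _)); ring.
  by rewrite big_ord1 !pintZ -mulrDr mulrA divff ?mul1r// gt_eqF.
(* F collects the left traces by node instead of by cell *)
pose F j := (P (cyc_pred N j)).[2] * fl j.
have predN (T : Type) (G : nat -> T) j : cyclic_seq N G -> G (cyc_pred N (j + N)) = G (cyc_pred N j).
  by move=> GN; rewrite -[RHS]GN; congr G; rewrite /cyc_pred; lia.
have FN : cyclic_seq N F.
  by move=> j; rewrite /F /fl (predN _ _ _ PN) (predN _ _ _ QN) (predN _ _ _ WN) WN.
under eq_bigr => j _.
  rewrite cell !flE (trace_r_cellwise _ d0 phiP) (trace_l_cellwise _ N0 d0 phiL phiP).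
  rewrite -/(F j.+1) addrAC; over.
rewrite big_split /= sumrN (sum_cyc_succ N0 FN) -sumrN -big_split /=.
rewrite /coupling /jumps mulr_sumr -big_split /=; apply: eq_bigr => j _.
by rewrite /F /fl; ring.
Qed.

End Cells.

(** * The operator bound *)

Section Assembly.
Variable R : realType.
Implicit Types (c beta tau xL xR : R) (N qu qv : nat).

Lemma sqnorm_ge0 N (P : nat -> {poly R}) : 0 <= sqnorm N P.
Proof. by apply: sumr_ge0 => j _; exact: pint_sqr_ge0. Qed.

Lemma sqnorm_succ N (P : nat -> {poly R}) : (0 < N)%N -> cyclic_seq N P ->
  sqnorm N (fun j => P j.+1) = sqnorm N P.
Proof.
move=> N0 PN; apply: (sum_cyc_succ (F := fun j => pint 0 2 (P j ^+ 2))) => // j.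
by rewrite PN.
Qed.

Section Grid.
Variables (xL xR : R) (N : nat).
Hypotheses (xLR : xL < xR) (N0 : (0 < N)%N).
Let d := width N xL xR / 2.

Lemma half_width_gt0 : 0 < d.
Proof. by rewrite !divr_gt0 ?subr_gt0 ?ltr0n. Qed.

Lemma half_widthMN : 2 * N%:R * d = xR - xL.
Proof. by rewrite /d /width; field; rewrite pnatr_eq0 -lt0n. Qed.

Lemma xRE : xR = xL + 2 * N%:R * d.
Proof. by rewrite half_widthMN; ring. Qed.

Lemma nodeE j : node N xL xR j = xL + 2 * j%:R * d.
Proof. by rewrite /node /d; field. Qed.

Lemma dual_nodeE j : dual_node N xL xR j = xL + d + 2 * j%:R * d.
Proof. by rewrite /dual_node !nodeE -natr1; field. Qed.

Lemma broken_cellwise a (brk : nat -> R) k w :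
  (forall j, brk j = a + 2 * j%:R * d) -> broken_poly N (xR - xL) brk k w ->
  periodic w (2 * N%:R * d) /\
  exists P : nat -> {poly R}, [/\ cyclic_seq N P, forall j, (size (P j) <= k.+1)%N & cellwise a d w P].
Proof.
move=> brkE [wL wp]; rewrite -half_widthMN in wL; split => //.
apply: cellwise_exists => //; first exact: half_width_gt0.
by move=> j jN; have [p sp pE] := wp j jN; exists p => // x; rewrite -!brkE => /pE.
Qed.

Lemma dg_form_eq c beta tau w v phi psi W V P S :
  let L := 2 * N%:R * d in
  [/\ periodic w L, periodic v L, periodic phi L & periodic psi L] ->
  [/\ cyclic_seq N W, cyclic_seq N V, cyclic_seq N P & cyclic_seq N S] ->
  [/\ cellwise xL d w W, cellwise (xL + d) d v V,
      cellwise xL d phi P & cellwise (xL + d) d psi S] ->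
  dg_form N xL xR c beta tau w v phi psi =
  - c ^+ 2 * (coupling N P V + beta * c ^+ 2 * jumps N P W)
  - c ^+ 2 * (coupling N S (fun j => W j.+1) + tau / c ^+ 2 * jumps N S V).
Proof.
move=> L [wL vL phiL psiL] [WN VN PN SN] [wW vV phiP psiS].
have d0 := half_width_gt0.
rewrite -(half_form_eq _ N0 d0 phiL wL vL PN WN VN phiP wW vV).
rewrite -(half_form_eq _ N0 d0 psiL vL wL SN VN _ psiS vV (cellwise_shift wW)); last first.
  by move=> j; rewrite -addSn WN.
rewrite /dg_form; congr (_ * _ - _ * _); apply: eq_bigr => j _.
  by rewrite !nodeE.
by rewrite !dual_nodeE.
Qed.

Lemma L2norm_sqr w (W : nat -> {poly R}) : cellwise xL d w W ->
  L2norm xL xR w ^+ 2 = d * sqnorm N W.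
Proof.
move=> wW; rewrite /L2norm xRE (integral_cellwise_sqr N0 half_width_gt0 wW).
by rewrite sqr_sqrtr// mulr_ge0 ?sqnorm_ge0// ltW// half_width_gt0.
Qed.

Lemma L2norm_dual_sqr v (V : nat -> {poly R}) :
  periodic v (2 * N%:R * d) -> cyclic_seq N V -> cellwise (xL + d) d v V ->
  L2norm xL xR v ^+ 2 = d * sqnorm N V.
Proof.
move=> vL VN vV; rewrite /L2norm xRE (integral_cellwise_dual_sqr N0 half_width_gt0 vL VN vV).
by rewrite sqr_sqrtr// mulr_ge0 ?sqnorm_ge0// ltW// half_width_gt0.
Qed.

Lemma L2norm_scale_sqr c w (W : nat -> {poly R}) : cellwise xL d w W ->
  L2norm xL xR (c \*o w) ^+ 2 = c ^+ 2 * (d * sqnorm N W).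
Proof.
move=> wW; rewrite (L2norm_sqr (W := fun j => c *: W j)); last first.
  by move=> j t t02; rewrite /= wW// hornerZ.
rewrite /sqnorm mulrCA [in RHS]mulr_sumr; congr (_ * _); apply: eq_bigr => j _.
by rewrite exprZn pintZ.
Qed.

End Grid.

(** The weights of the four applications are chosen so that w and v always carry
    e, phi and psi always 1 / e, and w and phi the factor c^2 of the energy
    norm. *)
Lemma form_young c beta tau qu qv N (W V P S : nat -> {poly R}) e :
  0 < c -> 0 <= beta -> 0 <= tau -> (0 < N)%N -> (0 < qu)%N ->
  [/\ cyclic_seq N W, cyclic_seq N V, cyclic_seq N P & cyclic_seq N S] ->
  (forall j, [/\ (size (W j) <= qu)%N, (size (V j) <= qv.+1)%N,
     (size (P j) <= qu)%N & (size (S j) <= qv.+1)%N]) -> 0 < e ->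
  - c ^+ 2 * (coupling N P V + beta * c ^+ 2 * jumps N P W)
  - c ^+ 2 * (coupling N S (fun j => W j.+1) + tau / c ^+ 2 * jumps N S V)
  <= c * ((qu%:R + qv%:R + 1) / 2
          + Num.max (c * beta * qu%:R ^+ 2) (tau / c * (qv%:R + 1) ^+ 2))
     * (e * (c ^+ 2 * sqnorm N W + sqnorm N V)
        + e^-1 * (c ^+ 2 * sqnorm N P + sqnorm N S)).
Proof.
move=> c0 beta0 tau0 N0 qu0 [WN VN PN SN] sz e0.
have sW j : (size (W j) <= qu.-1.+1)%N by rewrite prednK//; case: (sz j).
have sV j : (size (V j) <= qv.+1)%N by case: (sz j).
have sP j : (size (P j) <= qu.-1.+1)%N by rewrite prednK//; case: (sz j).
have sS j : (size (S j) <= qv.+1)%N by case: (sz j).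
have ie0 : 0 < e^-1 by rewrite invr_gt0.
have ic0 : 0 < c^-1 by rewrite invr_gt0.
have W'N : cyclic_seq N (fun j => W j.+1) by move=> j; rewrite -addSn WN.
have sW' j : (size (W j.+1) <= qu.-1.+1)%N by exact: sW.
have := coupling_le N0 PN VN sP sV (mulr_gt0 c0 ie0).
have := coupling_le N0 SN W'N sS sW' (mulr_gt0 ic0 ie0).
have := jumps_le N0 PN WN sP sW ie0.
have := jumps_le N0 SN VN sS sV ie0.
rewrite (sqnorm_succ N0 WN) prednK// [(c * e^-1)^-1]invfM [(c^-1 * e^-1)^-1]invfM !invrK.
have -> : qu.-1%:R = qu%:R - 1 :> R by rewrite -[in RHS](prednK qu0) -natr1 addrK.
rewrite -natr1.
move: (sqnorm_ge0 N W) (sqnorm_ge0 N V) (sqnorm_ge0 N P) (sqnorm_ge0 N S).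
move: (sqnorm N W) (sqnorm N V) (sqnorm N P) (sqnorm N S) => sqW sqV sqP sqS W0 V0 P0 S0.
move: (jumps N S V) (jumps N P W) (coupling N S _) (coupling N P V) => j1 j2 k1 k2.
set M := Num.max _ _.
have M1 : c * beta * qu%:R ^+ 2 <= M by rewrite le_max lexx.
have M2 : tau / c * (qv%:R + 1) ^+ 2 <= M by rewrite le_max lexx orbT.
have cN (x y z : R) : 0 <= z -> `|x| <= y -> - (z * x) <= z * y.
  move=> z0 xy; rewrite -mulrN ler_wpM2l//; apply: le_trans xy.
  by have := ler_norm (- x); rewrite normrN.
move: (e^-1) ie0 => g g0.
have c2 : 0 <= c ^+ 2 by rewrite sqr_ge0.
have X (a b : R) : 0 <= a -> 0 <= b -> 0 <= c * (e * a + g * b).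
  by move=> a0 b0; rewrite mulr_ge0 ?addr_ge0 ?mulr_ge0// ltW.
move=> /(cN _ _ _ tau0) H1 /(cN _ _ _ (mulr_ge0 c2 (mulr_ge0 beta0 c2))) H2.
move=> /(cN _ _ _ c2) H3 /(cN _ _ _ c2) H4.
have H1' : - (tau * j1) <= M * (c * (e * sqV + g * sqS)).
  apply: (le_trans H1); apply: le_trans (ler_wpM2r (X _ _ V0 S0) M2).
  by rewrite le_eqVlt; apply/orP; left; apply/eqP; field; rewrite gt_eqF.
have H2' : - (c ^+ 2 * (beta * c ^+ 2) * j2) <= M * (c * (e * (c ^+ 2 * sqW) + g * (c ^+ 2 * sqP))).
  apply: (le_trans H2); apply: le_trans (ler_wpM2r (X _ _ (mulr_ge0 c2 W0) (mulr_ge0 c2 P0)) M1).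
  by rewrite le_eqVlt; apply/orP; left; apply/eqP; ring.
have E3 : c ^+ 2 * (tau / c ^+ 2 * j1) = tau * j1 by field; rewrite gt_eqF.
set K := (qu%:R + qv%:R + 1) / 2.
have H3' : - (c ^+ 2 * k1) <= K * (c * (e * (c ^+ 2 * sqW) + g * sqS)).
  by apply: (le_trans H3); rewrite le_eqVlt /K; apply/orP; left; apply/eqP; field; rewrite gt_eqF.
have H4' : - (c ^+ 2 * k2) <= K * (c * (e * sqV + g * (c ^+ 2 * sqP))).
  by apply: (le_trans H4); rewrite le_eqVlt /K; apply/orP; left; apply/eqP; field; rewrite gt_eqF.
rewrite !mulNr !mulrDr E3.
move: (K) (M) H1' H2' H3' H4' => K' M'; clear; lra.
Qed.

(** The choice e = B / A turns e A^2 + B^2 / e into 2 A B. *)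
Lemma dg_form_le c beta tau xL xR N qu qv w v phi psi :
  0 < c -> 0 <= beta -> 0 <= tau -> xL < xR -> (0 < N)%N -> (0 < qu)%N ->
  Uh N xL xR qu.-1 w -> Vh N xL xR qv v ->
  Uh N xL xR qu.-1 phi -> Vh N xL xR qv psi ->
  let A := Num.sqrt (L2norm xL xR (c \*o w) ^+ 2 + L2norm xL xR v ^+ 2) in
  let B := Num.sqrt (L2norm xL xR (c \*o phi) ^+ 2 + L2norm xL xR psi ^+ 2) in
  0 < A -> 0 < B ->
  dg_form N xL xR c beta tau w v phi psi <=
    c / width N xL xR * (2 * (qu%:R + qv%:R + 1)
      + 4 * Num.max (c * beta * qu%:R ^+ 2) (tau / c * (qv%:R + 1) ^+ 2)) * (A * B).
Proof.
move=> c0 beta0 tau0 xLR N0 qu0 wU vV phiU psiV A B A0 B0.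
have d0 := half_width_gt0 xLR N0.
have [wL [W [WN sW cW]]] := broken_cellwise xLR N0 (nodeE xL xR N) wU.
have [vL [V [VN sV cV]]] := broken_cellwise xLR N0 (dual_nodeE xL xR N) vV.
have [phiL [P [PN sP cP]]] := broken_cellwise xLR N0 (nodeE xL xR N) phiU.
have [psiL [S [SN sS cS]]] := broken_cellwise xLR N0 (dual_nodeE xL xR N) psiV.
rewrite (@dg_form_eq _ _ _ xLR N0 c beta tau w v phi psi W V P S)//.
have A2 : A ^+ 2 = width N xL xR / 2 * (c ^+ 2 * sqnorm N W + sqnorm N V).
  rewrite sqr_sqrtr ?addr_ge0 ?sqr_ge0//.
  by rewrite (L2norm_scale_sqr xLR N0 _ cW) (L2norm_dual_sqr xLR N0 vL VN cV) mulrDr mulrCA.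
have B2 : B ^+ 2 = width N xL xR / 2 * (c ^+ 2 * sqnorm N P + sqnorm N S).
  rewrite sqr_sqrtr ?addr_ge0 ?sqr_ge0//.
  by rewrite (L2norm_scale_sqr xLR N0 _ cP) (L2norm_dual_sqr xLR N0 psiL SN cS) mulrDr mulrCA.
(* both square norms carry a factor h / 2, the Jacobian of the reference map *)
apply: le_trans (form_young (e := B / A) c0 beta0 tau0 N0 qu0 _ _ _) _.
- by [].
- by move=> j; have := sW j; have := sP j; rewrite prednK// => ? ?; split.
- exact: divr_gt0.
have h0 : width N xL xR != 0 by move: d0; rewrite pmulr_lgt0 ?invr_gt0// => /gt_eqF ->.
have -> : c ^+ 2 * sqnorm N W + sqnorm N V = 2 / width N xL xR * A ^+ 2.
  by rewrite A2; field.
have -> : c ^+ 2 * sqnorm N P + sqnorm N S = 2 / width N xL xR * B ^+ 2.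
  by rewrite B2; field.
rewrite le_eqVlt; apply/orP; left; apply/eqP; field.
by rewrite h0 !gt_eqF.
Qed.

(** When a norm in the denominator vanishes the quotient is 0 by convention. *)
Lemma dg_opnorm_le c beta tau xL xR N qu qv Lc :
  0 < c -> 0 <= beta -> 0 <= tau -> xL < xR -> (0 < N)%N -> (0 < qu)%N ->
  is_dg_operator N xL xR c beta tau qu qv Lc ->
  (dg_opnorm N xL xR c qu qv Lc <=
   (c / width N xL xR * (2 * (qu%:R + qv%:R + 1)
      + 4 * Num.max (c * beta * qu%:R ^+ 2) (tau / c * (qv%:R + 1) ^+ 2)))%:E)%E.
Proof.
move=> c0 beta0 tau0 xLR N0 qu0 [_ LcE]; apply: ge_ereal_sup.
move=> _ [w [v [phi [psi [[wU vV] [phiU psiV] _ _ ->]]]]].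
rewrite lee_fin LcE//.
have K0 : 0 <= c / width N xL xR * (2 * (qu%:R + qv%:R + 1)
      + 4 * Num.max (c * beta * qu%:R ^+ 2) (tau / c * (qv%:R + 1) ^+ 2)).
  have h0 : 0 < width N xL xR by rewrite divr_gt0 ?subr_gt0 ?ltr0n.
  apply: mulr_ge0; first by rewrite divr_ge0// ltW.
  apply: addr_ge0; first by rewrite mulr_ge0// !addr_ge0 ?ler0n.
  by rewrite mulr_ge0// le_max mulr_ge0 ?sqr_ge0// mulr_ge0// ltW.
have := dg_form_le c0 beta0 tau0 xLR N0 qu0 wU vV phiU psiV.
set A := Num.sqrt _; set B := Num.sqrt _ => H.
have [A0|A0] := eqVneq A 0; first by rewrite A0 mul0r invr0 mulr0.
have [B0|B0] := eqVneq B 0; first by rewrite B0 mulr0 invr0 mulr0.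
have {}A0 : 0 < A by rewrite lt_neqAle eq_sym A0 sqrtr_ge0.
have {}B0 : 0 < B by rewrite lt_neqAle eq_sym B0 sqrtr_ge0.
by rewrite ler_pdivrMr ?mulr_gt0// H.
Qed.

End Assembly.

Lemma sqrt_mul_ge1 (R : realType) (qu qv : nat) : (0 < qu)%N ->
  1 <= Num.sqrt (qu%:R * (qv%:R + 1) : R).
Proof.
move=> qu0; rewrite -[1 in leLHS]sqrtr1 ler_sqrt ?mulr_ge0 ?addr_ge0 ?ler0n//.
by rewrite natr1 -natrM ler1n muln_gt0 qu0.
Qed.

Theorem theorem2 (R : realType) :
  (exists C3 C4 C5 : R,
    [/\ 0 < C3 /\ C3 <= (8 * Num.sqrt 3 + 4) / 3,
        0 < C4 /\ C4 <= 128 / (Num.sqrt 3 * pi),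
        0 < C5 /\ C5 <= 4 &
        forall (c beta tau xL xR : R) (N qu qv : nat)
          (Lc : (R -> R) * (R -> R) -> (R -> R) * (R -> R)),
          0 < c -> 0 <= beta -> 0 <= tau -> xL < xR ->
          (0 < N)%N -> (0 < qu)%N ->
          is_dg_operator N xL xR c beta tau qu qv Lc ->
          let h := width N xL xR in
          (dg_opnorm N xL xR c qu qv Lc <=
            (c / h * C3 * (qu%:R + qv%:R - 1)
             + c / h * C4 * Num.sqrt (qu%:R * (qv%:R + 1))
             + c / h * C5 * Num.max (c * beta * qu%:R ^+ 2)
                                    (tau / c * (qv%:R + 1) ^+ 2))%:E)%E])
  /\
  (exists C : R,
    forall (c xL xR : R) (N qu qv : nat)
      (Lc : (R -> R) * (R -> R) -> (R -> R) * (R -> R)),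
      0 < c -> xL < xR -> (0 < N)%N -> (0 < qu)%N ->
      is_dg_operator N xL xR c 0 0 qu qv Lc ->
      let h := width N xL xR in
      (dg_opnorm N xL xR c qu qv Lc
         <= (C * (c / h) * (qu%:R + qv%:R))%:E)%E)
  /\
  (forall betah tauh : R, 0 <= betah -> 0 <= tauh ->
    exists C : R,
    forall (c beta tau xL xR : R) (N qu qv : nat)
      (Lc : (R -> R) * (R -> R) -> (R -> R) * (R -> R)),
      0 < c -> xL < xR -> (0 < N)%N -> (0 < qu)%N ->
      beta = betah / (qu%:R * c) ->
      tau = c * tauh / (qv%:R + 1) ->
      is_dg_operator N xL xR c beta tau qu qv Lc ->
      let h := width N xL xR in
      (dg_opnorm N xL xR c qu qv Lc
         <= (C * (c / h) * (qu%:R + qv%:R))%:E)%E).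
Proof.
have hpos (xL xR : R) N : xL < xR -> (0 < N)%N -> 0 < width N xL xR.
  by move=> xLR N0; rewrite divr_gt0 ?subr_gt0 ?ltr0n.
have q1 (qu qv : nat) : (0 < qu)%N -> 1 <= qu%:R :> R /\ 0 <= qv%:R :> R.
  by move=> qu0; rewrite ler1n ler0n.
have linear (betah tauh c beta tau xL xR : R) (N qu qv : nat) Lc :
    0 <= betah -> 0 <= tauh ->
    0 < c -> xL < xR -> (0 < N)%N -> (0 < qu)%N ->
    beta = betah / (qu%:R * c) -> tau = c * tauh / (qv%:R + 1) ->
    is_dg_operator N xL xR c beta tau qu qv Lc ->
    (dg_opnorm N xL xR c qu qv Lc <=
      ((4 + 4 * (betah + tauh)) * (c / width N xL xR) * (qu%:R + qv%:R))%:E)%E.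
  move=> bh0 th0 c0 xLR N0 qu0 betaE tauE LcP.
  have [qu1 qv0] := q1 qu qv qu0; have h0 := hpos _ _ _ xLR N0.
  have quR : 0 < qu%:R :> R by rewrite ltr0n.
  have qvR : 0 < qv%:R + 1 :> R by rewrite ltr_wpDl.
  have beta0 : 0 <= beta by rewrite betaE divr_ge0// mulr_ge0 ?ltW//.
  have tau0 : 0 <= tau by rewrite tauE divr_ge0 ?mulr_ge0// ?ltW//.
  apply: le_trans (dg_opnorm_le c0 beta0 tau0 xLR N0 qu0 LcP) _.
  have -> : c * beta * qu%:R ^+ 2 = betah * qu%:R.
    by rewrite betaE; field; rewrite !gt_eqF.
  have -> : tau / c * (qv%:R + 1) ^+ 2 = tauh * (qv%:R + 1).
    by rewrite tauE; field; rewrite !gt_eqF.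
  rewrite lee_fin [leRHS]mulrAC [leRHS]mulrC.
  apply: ler_wpM2l; first by rewrite divr_ge0// ltW.
  have : Num.max (betah * qu%:R) (tauh * (qv%:R + 1)) <= (betah + tauh) * (qu%:R + qv%:R).
    by rewrite ge_max; apply/andP; split; nra.
  lra.
split; last split.
- exists 2, 4, 4.
  have s1 : 1 <= Num.sqrt 3 :> R by rewrite -[1 in leLHS]sqrtr1 ler_sqrt// ler1n.
  have s2 : Num.sqrt 3 <= 2 :> R.
    by rewrite -(@ler_pXn2r _ 2) ?nnegrE ?sqrtr_ge0// sqr_sqrtr// -natrX ler_nat.
  have p4 : pi <= 4 :> R by have := pihalf_lt2 R; lra.
  have p0 := pi_gt0 R.
  split.
  + by split => //; lra.
  + split => //; rewrite ler_pdivlMr ?mulr_gt0 ?sqrtr_gt0//.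
    nra.
  + by [].
  move=> c beta tau xL xR N qu qv Lc c0 beta0 tau0 xLR N0 qu0 LcP /=.
  apply: le_trans (dg_opnorm_le c0 beta0 tau0 xLR N0 qu0 LcP) _.
  have := @sqrt_mul_ge1 R _ qv qu0; have h0 := hpos _ _ _ xLR N0.
  rewrite lee_fin; move: (Num.sqrt (qu%:R * _)) (Num.max _ _) => s M s_ge1.
  rewrite [leRHS](_ : _ = c / width N xL xR *
    (2 * (qu%:R + qv%:R - 1) + 4 * s + 4 * M)); last by ring.
  apply: ler_wpM2l; first by rewrite divr_ge0// ltW.
  lra.
- exists 4 => c xL xR N qu qv Lc c0 xLR N0 qu0 LcP /=.
  have -> : 4 = 4 + 4 * (0 + 0) :> R by rewrite addr0 mulr0 addr0.
  by apply: linear LcP; rewrite ?mulr0 ?mul0r.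
move=> betah tauh bh0 th0; exists (4 + 4 * (betah + tauh)).
move=> c beta tau xL xR N qu qv Lc; exact: linear.
Qed.
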